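(* Let $q$ be a real number with $|q|<1$, $d,n$ positive integers and $0\le k\le n$ an integer. Then $$\det\left(\begin{bmatrix} n+d+j-i-1\\ n-1\end{bmatrix}_q\right)_{i,j=0}^{k-1}=q^{\binom{k}{2}d}\left\langle \begin{matrix} n\\ k\end{matrix}\right\rangle_{d,q}.$$
   Context: For integers $0\le k\le m$, $\begin{bmatrix} m\\ k\end{bmatrix}_q=\prod_{j=0}^{k-1}\frac{1-q^{m-j}}{1-q^{k-j}}$, and $\begin{bmatrix} m\\ k\end{bmatrix}_q=0$ if $k<0$ or $k>m$. For $0\le k\le n$, $\left\langle \begin{matrix} n\\ k\end{matrix}\right\rangle_{d,q}=\prod_{j=0}^{k-1}\frac{\begin{bmatrix} n-j+d-1\\ d\end{bmatrix}_q}{\begin{bmatrix} k-j+d-1\\ d\end{bmatrix}_q}$. A $0\times 0$ determinant equals $1$. *)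

(* Defs.v *)
From mathcomp Require Import all_boot all_order all_algebra.
From mathcomp Require Import reals.

Set Implicit Arguments.
Unset Strict Implicit.
Unset Printing Implicit Defensive.

Import Order.TTheory GRing.Theory Num.Theory.

Local Open Scope ring_scope.

(* The indices are naturals, so the case "k < 0" of the convention that the
   q-binomial coefficient vanishes outside 0 <= k <= m does not arise. *)
Definition qbinom (R : realType) (q : R) (m k : nat) : R :=
  if (k <= m)%N then
    \prod_(j < k) ((1 - q ^+ (m - j)) / (1 - q ^+ (k - j)))
  else 0.

(* Meaningful for k <= n and 0 < d, where no subtraction is truncated. *)
Definition dqbinom (R : realType) (d : nat) (q : R) (n k : nat) : R :=
  \prod_(j < k) (qbinom q (n - j + d - 1) d / qbinom q (k - j + d - 1) d).

(* Main.v *)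
Require Import Defs.
From mathcomp Require Import all_boot all_order all_algebra.
From mathcomp Require Import reals.
From mathcomp Require Import zify ring.

(* For q <> 0, the q-Chu-Vandermonde identity writes the matrix as the product
   of ([n+d-1-i; n-1-l]_q)_(i,l) and a unitriangular matrix.  Up to row and
   column factors, the (i,j) entry of the remaining matrix is
   (q;q)_(d+j) / (q;q)_(d+j-i), the value at q^j of a polynomial of degree i,
   so its determinant reduces to a Vandermonde determinant.  The polynomial
   involves q^-1; for q = 0 and k >= 2 the first two rows are equal. *)

Set Implicit Arguments.
Unset Strict Implicit.
Unset Printing Implicit Defensive.

Import Order.TTheory GRing.Theory Num.Theory.

Local Open Scope ring_scope.

(** The q-Pochhammer symbol (q;q)_m. *)
Definition qfact (R : realType) (q : R) (m : nat) : R :=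
  \prod_(i < m) (1 - q ^+ i.+1).

(** * Determinants of scaled matrices and of polynomial values *)

Section Determinants.
Variable R : comNzRingType.

Lemma det_scale_row_col k (u v : 'I_k -> R) (A : 'M[R]_k) :
  \det (\matrix_(i, j) (u i * A i j * v j)) =
  (\prod_i u i) * \det A * (\prod_j v j).
Proof.
have -> : \matrix_(i, j) (u i * A i j * v j) =
  diag_mx (\row_i u i) *m A *m diag_mx (\row_j v j).
  by apply/matrixP=> i j; rewrite mul_mx_diag mul_diag_mx !mxE.
by rewrite !det_mulmx !det_diag; congr (_ * _ * _); apply: eq_bigr => i _;
  rewrite mxE.
Qed.

(** The matrix is the coefficient matrix, lower triangular by the degree bound, times the
    Vandermonde matrix of [x]. *)
Lemma det_poly_eval k (p : 'I_k -> {poly R}) (x : 'I_k -> R) :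
  (forall i, size (p i) <= i.+1)%N ->
  \det (\matrix_(i, j) (p i).[x j]) =
  (\prod_i (p i)`_i) * \prod_(i < k) \prod_(j < k | (i < j)%N) (x j - x i).
Proof.
move=> size_p.
have -> : \matrix_(i, j) (p i).[x j] =
  (\matrix_(i, l) (p i)`_(l : 'I_k)) *m Vandermonde k (\row_j x j).
  apply/matrixP=> i j; rewrite !mxE (@horner_coef_wide _ k).
    by apply: eq_bigr => l _; rewrite !mxE.
  exact: leq_trans (size_p i) (ltn_ord i).
rewrite det_mulmx det_Vandermonde det_trig.
  congr (_ * _); first by apply: eq_bigr => i _; rewrite mxE.
  by apply: eq_bigr => i _; apply: eq_bigr => j _; rewrite !mxE.
apply/is_trig_mxP=> i j lt_ij; rewrite mxE nth_default //.
exact: leq_trans (size_p i) lt_ij.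
Qed.

End Determinants.

Section LinearFactors.
Variable R : idomainType.
Implicit Types c : nat -> R.

Lemma size_prod_linear c i :
  (size (\prod_(s < i) (1 - (c s)%:P * 'X))%R <= i.+1)%N.
Proof.
elim: i => [|i IHi]; first by rewrite big_ord0 size_poly1.
rewrite big_ord_recr /= mulrBr mulr1 mulrCA mul_polyC.
rewrite (leq_trans (size_polyD _ _)) // geq_max (leq_trans IHi) //= size_polyN.
by rewrite (leq_trans (size_scale_leq _ _)) // (leq_trans (size_polyMleq _ _)) //
  size_polyX addn2.
Qed.

Lemma coef_prod_linear c i :
  (\prod_(s < i) (1 - (c s)%:P * 'X))`_i = \prod_(s < i) - c s.
Proof.
elim: i => [|i IHi]; first by rewrite !big_ord0 coef1.
rewrite !big_ord_recr /= mulrBr mulr1 coefB nth_default ?size_prod_linear //.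
by rewrite mulrCA coefCM coefMX /= IHi sub0r mulrN mulrC.
Qed.

End LinearFactors.

(** * q-factorials, q-binomials and the q-Chu-Vandermonde identity *)

Section QBinomial.
Variables (R : realType) (q : R).
Hypothesis hq : `|q| < 1.

Lemma qfactS m : qfact q m.+1 = qfact q m * (1 - q ^+ m.+1).
Proof. by rewrite /qfact big_ord_recr. Qed.

Lemma subr1_expr_neq0 m : 1 - q ^+ m.+1 != 0.
Proof.
rewrite subr_eq0; apply/negP => /eqP e.
have : `|q ^+ m.+1| < 1 by rewrite normrX exprn_ilt1.
by rewrite -e normr1 ltxx.
Qed.

Lemma qfact_neq0 m : qfact q m != 0.
Proof. by apply/prodf_neq0 => i _; exact: subr1_expr_neq0. Qed.

Lemma qfact_rev m : qfact q m = \prod_(i < m) (1 - q ^+ (m - i)).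
Proof.
rewrite /qfact (reindex_inj rev_ord_inj) /=; apply: eq_bigr => i _.
by rewrite subnSK.
Qed.

Lemma qfact_split m k : (k <= m)%N ->
  qfact q m = qfact q (m - k) * \prod_(i < k) (1 - q ^+ (m - i)).
Proof.
elim: k => [|k IHk] lekm; first by rewrite subn0 big_ord0 mulr1.
rewrite IHk ?(ltnW lekm) // big_ord_recr /= -(subnSK lekm) qfactS.
by rewrite subnSK // mulrAC mulrA.
Qed.

Lemma qbinomE m k : (k <= m)%N ->
  qbinom q m k = qfact q m / (qfact q k * qfact q (m - k)).
Proof.
move=> lekm; rewrite /qbinom lekm big_split /= prodfV -qfact_rev.
by rewrite (qfact_split lekm); field; rewrite !qfact_neq0.
Qed.

Lemma qbinom_small m k : (m < k)%N -> qbinom q m k = 0.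
Proof. by rewrite /qbinom ltnNge; case: leqP. Qed.

Lemma qbinom0 m : qbinom q m 0 = 1.
Proof. by rewrite /qbinom big_ord0. Qed.

Lemma qbinomnn m : qbinom q m m = 1.
Proof.
by rewrite qbinomE // subnn /qfact big_ord0 mulr1 divff // qfact_neq0.
Qed.

Lemma qbinomS m r :
  qbinom q m.+1 r.+1 = qbinom q m r + q ^+ r.+1 * qbinom q m r.+1.
Proof.
case: (ltngtP r m) => [lt_rm|lt_mr|->]; last first.
- by rewrite !qbinomnn qbinom_small // mulr0 addr0.
- by rewrite !qbinom_small ?mulr0 ?addr0 //; lia.
have [t ->] : exists t, m = (r + t.+1)%N by exists (m - r.+1)%N; lia.
rewrite !qbinomE; try lia.
have -> : ((r + t.+1).+1 - r.+1 = t.+1)%N by lia.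
have -> : (r + t.+1 - r = t.+1)%N by lia.
have -> : (r + t.+1 - r.+1 = t)%N by lia.
rewrite !qfactS -addSn exprD.
by field; rewrite !qfact_neq0 !subr1_expr_neq0.
Qed.

(** Induction on [j] by the q-Pascal rule [qbinomS], applied on both sides. The bound [j <= r] keeps
    [r - l] from being truncated. *)
Lemma qVandermonde j m r : (j <= r)%N ->
  qbinom q (m + j) r =
  \sum_(l < j.+1) qbinom q m (r - l) * (qbinom q j l * q ^+ ((j - l) * (r - l))).
Proof.
elim: j r => [|j IHj] r lejr.
  by rewrite big_ord1 addn0 !subn0 mul0n !qbinom0 !mulr1.
case: r lejr => [|r] // lejr.
rewrite addnS qbinomS (IHj r) // (IHj r.+1) 1?ltnW //.
rewrite [RHS]big_ord_recl /=.
(* The part with [qbinom q j l] is the first sum on the left; the other part, together with the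
   split-off term [l = 0], gives the second. *)
under [in RHS]eq_bigr => l _ do
  rewrite /bump /= add1n qbinomS !subSS mulrDl mulrDr.
rewrite big_split /= [RHS]addrCA; congr (_ + _).
rewrite [in RHS]big_ord_recr /= (qbinom_small (ltnSn j)) mulr0 mul0r mulr0 addr0.
rewrite [in LHS]big_ord_recl /= mulrDr mulr_sumr; congr (_ + _).
  by rewrite !qbinom0 !subn0 !mul1r mulrCA -exprD mulSn.
apply: eq_bigr => l _; rewrite /bump /= add1n !subSS.
have -> : q ^+ ((j - l) * (r - l)) = q ^+ ((j - l.+1) * (r - l)) * q ^+ (r - l).
  by rewrite -exprD; congr (_ ^+ _); rewrite -(subnSK (ltn_ord l)) mulSn addnC.
have -> : q ^+ r.+1 = q ^+ l.+1 * q ^+ (r - l).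
  by rewrite -exprD; congr (_ ^+ _); have := ltn_ord l; lia.
ring.
Qed.

(** Padding with zero terms gives every [j < k] the same range, as a matrix product requires. *)
Lemma qVandermonde_wide k j m r : (j < k)%N -> (j <= r)%N ->
  qbinom q (m + j) r =
  \sum_(l < k) qbinom q m (r - l) * (qbinom q j l * q ^+ ((j - l) * (r - l))).
Proof.
move=> lt_jk /qVandermonde ->.
rewrite (big_ord_widen k (fun l => qbinom q m (r - l) *
  (qbinom q j l * q ^+ ((j - l) * (r - l))))) // big_mkcond /=.
apply: eq_bigr => l _; case: ltnP => // lt_jl.
by rewrite (qbinom_small lt_jl) mul0r mulr0.
Qed.

Lemma det_qbinom_reduce k m r : (k <= r.+1)%N -> (k <= m.+1)%N ->
  \det (\matrix_(i < k, j < k) qbinom q (m + j - i) r) =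
  \det (\matrix_(i < k, j < k) qbinom q (m - i) (r - j)).
Proof.
move=> lekr lekm.
pose C := \matrix_(l < k, j < k) (qbinom q j l * q ^+ ((j - l) * (r - l))).
have -> : \matrix_(i < k, j < k) qbinom q (m + j - i) r =
    (\matrix_(i < k, j < k) qbinom q (m - i) (r - j)) *m C.
  apply/matrixP=> i j; rewrite !mxE.
  have -> : (m + j - i = m - i + j)%N by have := ltn_ord i; lia.
  rewrite (@qVandermonde_wide k) //; last by have := ltn_ord j; lia.
  by apply: eq_bigr => l _; rewrite !mxE.
(* [C] is upper unitriangular, whereas [det_trig] expects a lower triangular matrix. *)
rewrite det_mulmx -[\det C]det_tr [\det C^T]det_trig.
  rewrite big1 ?mulr1 // => i _.
  by rewrite !mxE qbinomnn subnn mul0n mulr1.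
apply/is_trig_mxP => i j lt_ij.
by rewrite !mxE qbinom_small // mul0r.
Qed.

(** * Evaluation of the determinant for nonzero q *)

Hypothesis q0 : q != 0.

(* (q;q)_m / (q;q)_(m-i), extended by 0 to i > m *)
Lemma prod_falling m i :
  \prod_(s < i) (1 - q ^+ m / q ^+ s) =
  if (i <= m)%N then qfact q m / qfact q (m - i) else 0.
Proof.
case: leqP => [leim|ltmi].
  rewrite (qfact_split leim) mulrAC divff ?qfact_neq0 // mul1r.
  apply: eq_bigr => s _; rewrite expfB //.
  exact: leq_trans (ltn_ord s) leim.
(* The factor at [s = m] vanishes. *)
by apply/eqP/prodf_eq0; exists (Ordinal ltmi); rewrite //= divff ?subrr ?expf_neq0.
Qed.

Lemma det_falling k d :
  \det (\matrix_(i < k, j < k) \prod_(s < i) (1 - q ^+ (d + j) / q ^+ s)) =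
  q ^+ ('C(k, 2) * d) * \prod_(i < k) qfact q i.
Proof.
pose c s := q ^+ d / q ^+ s.
have -> : \matrix_(i < k, j < k) \prod_(s < i) (1 - q ^+ (d + j) / q ^+ s) =
  \matrix_(i < k, j < k) (\prod_(s < i) (1 - (c s)%:P * 'X)).[q ^+ j].
  apply/matrixP=> i j; rewrite !mxE horner_prod; apply: eq_bigr => s _.
  by rewrite !hornerE /c exprD mulrAC.
rewrite det_poly_eval => [|i]; last exact: size_prod_linear.
(* Grouped by the larger index [i], each Vandermonde factor [q ^+ i - q ^+ s] meets the coefficient
   factor [- c s]; their product is [q ^+ d * (1 - q ^+ (i - s))]. The powers of [q ^+ d] add up
   because ['C(k, 2)] is the sum of all [i < k]. *)
rewrite (exchange_big_dep predT) //= -big_split /= mulnC exprM.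
rewrite -triangular_sum (big_morph _ (exprD _) (expr0 _)) big_mkord -big_split /=.
apply: eq_bigr => i _; rewrite coef_prod_linear.
rewrite -(big_ord_widen k (fun s => q ^+ i - q ^+ s)) 1?ltnW // -big_split /=.
rewrite qfact_rev -[in q ^+ d ^+ i](card_ord i) -prodr_const -big_split /=.
apply: eq_bigr => s _; rewrite /c expfB //.
by field; rewrite expf_neq0.
Qed.

(** Expanding each entry by [qbinomE] and multiplying numerator and denominator by [qfact q (d + j)]
    leaves the entries of [det_falling] between row and column factors. *)
Lemma det_qbinom_shift k d r : (k <= r.+1)%N ->
  \det (\matrix_(i < k, j < k) qbinom q (r + d - i) (r - j)) =
  (\prod_(i < k) qfact q (r + d - i)) *
  (q ^+ ('C(k, 2) * d) * \prod_(i < k) qfact q i) *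
  \prod_(j < k) (qfact q (r - j) * qfact q (d + j))^-1.
Proof.
move=> lekr; rewrite -det_falling -det_scale_row_col; congr (\det _).
apply/matrixP=> i j; rewrite !mxE prod_falling.
have lt_ik := ltn_ord i; have lt_jk := ltn_ord j.
(* For [i > d + j] both sides are 0, since [r + d - i < r - j]. *)
case: leqP => leij; last by rewrite qbinom_small ?mulr0 ?mul0r //; lia.
rewrite qbinomE; last by lia.
have -> : (r + d - i - (r - j) = d + j - i)%N by lia.
by field; rewrite !qfact_neq0.
Qed.

End QBinomial.

Lemma dqbinomE (R : realType) (q : R) d n k : `|q| < 1 -> (k <= n)%N ->
  dqbinom d q n k =
  \prod_(j < k) (qfact q (n + d - j - 1) / qfact q (n - j - 1)) *
  \prod_(j < k) (qfact q j / qfact q (d + j)).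
Proof.
move=> hq lekn.
(* The denominators of [dqbinom] run through [d + j] in reverse order; in each quotient the factors
   [qfact q d] cancel. *)
rewrite [X in _ * X](reindex_inj rev_ord_inj) -big_split /=.
apply: eq_bigr => j _; have lt_jk := ltn_ord j.
rewrite !qbinomE //; try lia.
have -> : (n - j + d - 1 - d = n - j - 1)%N by lia.
have -> : (k - j + d - 1 - d = k - j.+1)%N by lia.
have -> : (n - j + d - 1 = n + d - j - 1)%N by lia.
have -> : (k - j + d - 1 = d + (k - j.+1))%N by lia.
by field; rewrite !qfact_neq0.
Qed.

(** * The degenerate case q = 0 *)

Lemma qbinom_q0 (R : realType) m k :
  qbinom (0 : R) m k = (k <= m)%N%:R.
Proof.
rewrite /qbinom; case: leqP => // lekm; rewrite big1 // => j _.
have lt_jk := ltn_ord j.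
by rewrite !expr0n !gtn_eqF ?subn_gt0 ?(leq_trans lt_jk) // !subr0 divr1.
Qed.

Lemma dqbinom_q0 (R : realType) d n k : (k <= n)%N ->
  dqbinom d (0 : R) n k = 1.
Proof.
move=> lekn; rewrite /dqbinom big1 // => j _; rewrite !qbinom_q0.
have lt_jk := ltn_ord j.
have -> : (d <= n - j + d - 1)%N by lia.
have -> : (d <= k - j + d - 1)%N by lia.
by rewrite divr1.
Qed.

Theorem theorem9 (R : realType) (q : R) (d n k : nat)
  (hq : `|q| < 1) (hd : (0 < d)%N) (hn : (0 < n)%N) (hk : (k <= n)%N) :
  \det (\matrix_(i < k, j < k) qbinom q (n + d + j - i - 1) (n - 1))
  = q ^+ ('C(k, 2) * d) * dqbinom d q n k.
Proof.
have [q0|q0] := eqVneq q 0.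
  (* As [0 < d], the right-hand side is 1 for [k <= 1] and 0 otherwise. *)
  rewrite {}q0 dqbinom_q0 // mulr1 expr0n muln_eq0 (gtn_eqF hd) orbF.
  case: k hk => [|[|k]] hk; first by rewrite det_mx00.
    rewrite det_mx11 mxE qbinom_q0 bin_small //=.
    by have -> : (n - 1 <= n + d + 0 - 0 - 1)%N by lia.
  rewrite (@determinant_alternate _ _ _ 0 1) // => [|j].
    by rewrite -leqn0 leqNgt bin_gt0.
  (* Both rows consist of ones: [n - 1 <= n + d + j - 2] because [0 < d]. *)
  rewrite !mxE !qbinom_q0 /=.
  have -> : (n - 1 <= n + d + j - 0 - 1)%N by lia.
  by have -> : (n - 1 <= n + d + j - 1 - 1)%N by lia.
(* Regrouped for the reduction with [m = n - 1 + d] and [r = n - 1]. *)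
have -> : \matrix_(i < k, j < k) qbinom q (n + d + j - i - 1) (n - 1) =
          \matrix_(i < k, j < k) qbinom q (n - 1 + d + j - i) (n - 1).
  by apply/matrixP=> i j; rewrite !mxE; congr qbinom; lia.
rewrite det_qbinom_reduce //; try lia.
rewrite det_qbinom_shift //; try lia.
rewrite dqbinomE // mulrCA -!mulrA; congr (_ * _).
rewrite mulrA -!big_split /=; apply: eq_bigr => j _.
have -> : (n - 1 + d - j = n + d - j - 1)%N by lia.
have -> : (n - 1 - j = n - j - 1)%N by lia.
by field; rewrite !qfact_neq0.
Qed.
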